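(* Let $(\lambda,\delta)$, $(\beta,\gamma)$ and $(\rho,\nu)$ be three proper pairs of partitions. Then for any $n\ge|\lambda|+|\delta|,\,|\beta|+|\gamma|,\,|\rho|+|\nu|$, the structure coefficient $c_{(\lambda,\delta)(\beta,\gamma)}^{(\rho,\nu)}(n)$ of the center of the hyperoctahedral group algebra $\mathbb{C}[\mathcal{B}_n]$ is a polynomial in $n$ with non-negative coefficients, and $$\deg\bigl(c_{(\lambda,\delta)(\beta,\gamma)}^{(\rho,\nu)}(n)\bigr)\le|\lambda|+|\delta|+|\beta|+|\gamma|-|\rho|-|\nu|.$$
   Context: $\mathcal{B}_n$ is the subgroup of the symmetric group $\mathcal{S}_{2n}$ of the permutations that map every pair $p(i)=\{2i-1,2i\}$, $1\le i\le n$, onto some pair $p(j)$. For $a\in p(i)$, $\overline{a}$ is the other element of $p(i)$. Each cycle in the disjoint cycle decomposition of $\omega\in\mathcal{B}_n$ is either of the form $(a_1,\dots,a_j,\overline{a_1},\dots,\overline{a_j})$, or is a cycle $\mathcal{C}=(a_1,\dots,a_l)$ not containing $\overline{a_1}$, in which case $\overline{\mathcal{C}}=(\overline{a_1},\dots,\overline{a_l})$ is another cycle of $\omega$. The type of $\omega$ is the pair of partitions $(\lambda,\delta)$, $|\lambda|+|\delta|=n$, where $\lambda$ has one part $l$ for each pair $\{\mathcal{C},\overline{\mathcal{C}}\}$ of cycles of length $l$ of the second kind, and $\delta$ has one part $j$ for each cycle of length $2j$ of the first kind. The conjugacy classes of $\mathcal{B}_n$ are the sets $\mathcal{H}_{(\lambda,\delta)}$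 of elements of type $(\lambda,\delta)$; the same symbol denotes the sum of the elements of the class in $\mathbb{C}[\mathcal{B}_n]$. A pair of partitions $(\lambda,\delta)$ is proper if $\lambda$ has no part equal to $1$. For a proper pair and $n\ge|\lambda|+|\delta|$, $(\lambda,\delta)^{\uparrow^n}=(\lambda\cup(1^{n-|\lambda|-|\delta|}),\delta)$, i.e. $n-|\lambda|-|\delta|$ parts equal to $1$ are added to $\lambda$. The structure coefficients are defined by $$\mathcal{H}_{(\lambda,\delta)^{\uparrow^n}}\mathcal{H}_{(\beta,\gamma)^{\uparrow^n}}=\sum_{(\rho,\nu)\text{ proper},\ |\rho|+|\nu|\le n}c_{(\lambda,\delta)(\beta,\gamma)}^{(\rho,\nu)}(n)\,\mathcal{H}_{(\rho,\nu)^{\uparrow^n}}.$$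
   Formalization: ''Non-negative coefficients'' is taken in the basis of shifted falling factorials (n-s)(n-s-1)...(n-s-k+1), s=|ρ|+|ν|, not in powers of n; the latter is false: the square of the class sum of ((2),∅) has coefficient n²-n at the identity. *)

(* Defs.v *)
From HB Require Import structures.
From mathcomp Require Import all_boot all_order all_algebra all_fingroup.
From mathcomp Require Import mxrepresentation complex.
From mathcomp Require Import boolp classical_sets fsbigop reals.

Set Implicit Arguments.
Unset Strict Implicit.
Unset Printing Implicit Defensive.

Import Order.TTheory GRing.Theory Num.Theory.

(* The set {1, ..., 2n} is represented by {0, ..., 2n-1} = 'I_(n.*2), so that
   the pairs p(1), ..., p(n) become {2i, 2i+1} for i < n. *)
Definition pairset (n : nat) (i : 'I_n) : {set 'I_(n.*2)} :=
  [set a | (val a == i.*2) || (val a == i.*2.+1)].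

Lemma bar_subproof (n : nat) (a : 'I_(n.*2)) :
  (if odd a then a.-1 else a.+1) < n.*2.
Proof.
case: ifPn => [_|even_a]; first exact: leq_ltn_trans (leq_pred a) (ltn_ord a).
rewrite ltn_neqAle ltn_ord andbT; apply: contra even_a => /eqP e.
have : odd (val a).+1 = false by rewrite [in LHS]e odd_double.
by move=> /= /negbFE.
Qed.

Definition bar (n : nat) (a : 'I_(n.*2)) : 'I_(n.*2) :=
  Ordinal (bar_subproof a).

Definition hyperoct_set (n : nat) : {set 'S_(n.*2)} :=
  [set w : 'S_(n.*2) |
     [forall i : 'I_n, exists j : 'I_n, w @: pairset i == pairset j]].

Lemma hyperoct_group_set (n : nat) : group_set (hyperoct_set n).
Proof.
apply/group_setP; split.
  rewrite inE; apply/forallP => i; apply/existsP; exists i; apply/eqP.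
  by apply/setP => a; rewrite -[X in X @: _]/(fun_of_perm 1%g)
    -{1}[a](perm1 a) mem_imset //; exact: perm_inj.
move=> v w; rewrite !inE => /forallP Hv /forallP Hw; apply/forallP => i.
have /existsP[j /eqP vi] := Hv i; have /existsP[k /eqP wj] := Hw j.
apply/existsP; exists k; rewrite -wj -vi -imset_comp; apply/eqP.
by apply: eq_imset => a; rewrite permM.
Qed.

Canonical hyperoct (n : nat) : {group 'S_(n.*2)} := Group (hyperoct_group_set n).

(* Partitions: nonincreasing sequences of positive integers. *)
Definition is_partition (s : seq nat) : bool := sorted geq s && (0 \notin s).

Record partition := Partition {
  parts :> seq nat;
  partsP : is_partition parts
}.

HB.instance Definition _ := [isSub for parts].
HB.instance Definition _ := [Choice of partition by <:].

Definition pairpart : choiceType := (partition * partition)%type.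

Definition wt (L : pairpart) : nat := sumn L.1 + sumn L.2.

Definition proper_pair (L : pairpart) : bool := 1 \notin parts L.1.

(* Cycles are identified with their supports (the elements of porbits w).  For
   w in the hyperoctahedral group, the support C of a cycle satisfies
   bar @: C = C when the cycle is (a_1, .., a_j, bar a_1, .., bar a_j), and
   otherwise bar @: C is the support of another cycle of w. *)
Definition selfbar (n : nat) (C : {set 'I_(n.*2)}) : bool :=
  @bar n @: C == C.

Definition selfbar_lengths (n : nat) (w : 'S_(n.*2)) : seq nat :=
  [seq #|C|./2 | C : {set 'I_(n.*2)} in [set C in porbits w | selfbar C]].

(* The unordered pairs {C, bar C} are elements of {set {set 'I_(n.*2)}}, so
   that each pair is counted once; the union of such a pair has 2l elements,
   where l is the common length of its two cycles. *)
Definition barpairs (n : nat) (w : 'S_(n.*2)) : {set {set {set 'I_(n.*2)}}} :=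
  [set [set C; @bar n @: C] | C : {set 'I_(n.*2)} in
     [set C in porbits w | ~~ selfbar C]].

Definition barpair_lengths (n : nat) (w : 'S_(n.*2)) : seq nat :=
  [seq #|finset.cover P|./2 | P : {set {set 'I_(n.*2)}} in barpairs w].

Definition has_type (n : nat) (w : 'S_(n.*2)) (l d : seq nat) : bool :=
  perm_eq (barpair_lengths w) l && perm_eq (selfbar_lengths w) d.

Definition Hset (n : nat) (l d : seq nat) : {set 'S_(n.*2)} :=
  [set w in hyperoct n | has_type w l d].

(* The completion (l, d)^{up n} of a pair of weight at most n. *)
Definition up1 (n : nat) (L : pairpart) : seq nat := L.1 ++ nseq (n - wt L) 1.

(* The class sum of L^{up n} in the group algebra F[B_n], which MathComp
   realises by the regular representation (group_ring, gset_mx): a faithful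
   algebra of #|B_n| x #|B_n| matrices, with product *m. *)
Definition Hsum (F : fieldType) (n : nat) (L : pairpart) : 'M[F]_#|hyperoct n| :=
  gset_mx F (hyperoct n) (Hset n (up1 n L) L.2).

Local Open Scope ring_scope.

(* c L M K n is the structure coefficient c_{L M}^K (n).  The class sums
   occurring on the right are linearly independent, hence these equations
   determine c L M K n for L, M, K proper of weight at most n. *)
Definition structure_coefs (F : fieldType)
    (c : pairpart -> pairpart -> pairpart -> nat -> F) : Prop :=
  forall (L M : pairpart) (n : nat), proper_pair L -> proper_pair M ->
    (wt L <= n)%N -> (wt M <= n)%N ->
    Hsum F n L *m Hsum F n M =
      \sum_(K \in [set K : pairpart | proper_pair K /\ (wt K <= n)%N]%classic)
        c L M K n *: Hsum F n K.

(* The polynomial (X - s)(X - s - 1) .. (X - s - k + 1). *)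
Definition ffact_poly (F : fieldType) (s k : nat) : {poly F} :=
  \prod_(i < k) ('X - ((s + i)%N%:R)%:P).

(* Non-negativity of coefficients refers to the basis of shifted falling
   factorials (n - s)(n - s - 1) .. (n - s - k + 1), equivalently of the
   binomials 'C(n - s, k), and not to the powers of n: the square of the class
   sum of ((2), ()) has coefficient n(n - 1) = n^2 - n at the identity. *)
Definition nonneg_ffact_coefs (F : numFieldType) (s : nat) (p : {poly F}) :
    Prop :=
  exists2 a : nat -> F, (forall k, 0 <= a k) &
    p = \sum_(k < size p) a k *: ffact_poly F s k.

(* Main.v *)
(* The coefficient is the number of factorizations x y = z with x, y of types
   L, M and z a fixed element of type K.  The set of pairs moved by x or y
   contains the wt K pairs moved by z and has at most wt L + wt M elements.
   Up to relabelling pairs, the number a_k of factorizations in which this set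
   is the support of z together with k given further pairs does not depend on
   n, so the coefficient is the sum of the a_k 'C(n - wt K, k). *)
Require Import Defs.
From mathcomp Require Import all_boot all_order all_algebra all_fingroup.
From mathcomp Require Import mxrepresentation complex reals.
From mathcomp Require classical_sets cardinality fsbigop.

Set Implicit Arguments.
Unset Strict Implicit.
Unset Printing Implicit Defensive.

Import GRing.Theory Num.Theory.

(** The relabelling shapes the proof: the numbers a_k compare factorizations in different groups,
    while a type in [hyperoct n] depends on [n] through its parts 1 and an element of ['S_(n.*2)] is
    tied to one [n]. Permutations are therefore taken on [X * bool] for an arbitrary finite set [X]
    of pairs, an injection between sets of pairs extends them by the identity, and types are read
    without the 1s, which makes them invariant under extension. Restricting a permutation to the
    pairs it moves then shows that the weight of its reduced type is the number of these pairs, and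
    a_k can be counted once and for all on the reference set [Z + 'I_k], where [Z] consists of the
    pairs moved by one fixed element of type K. The coefficients are only given through an identity
    in the group algebra. Reading them off needs an element in every class, which is built as a
    disjoint sum of explicit cycles. *)

Lemma perm_image_imset (T T' : finType) (U : eqType) (f : T -> T') (F : T' -> U)
    (A : {set T}) :
  {in A &, injective f} ->
  perm_eq [seq F x | x in f @: A] [seq F (f x) | x in A].
Proof.
move=> injf; rewrite /image_mem (map_comp F f); apply: perm_map.
apply: uniq_perm; first exact: enum_uniq.
  by rewrite map_inj_in_uniq ?enum_uniq // => x y; rewrite !mem_enum; exact: injf.
move=> y; rewrite mem_enum; apply/imsetP/mapP => -[x xA ->]; exists x => //.
  by rewrite mem_enum.
by rewrite mem_enum in xA.
Qed.

Lemma perm_image_setU (T : finType) (U : eqType) (F : T -> U) (A B : {set T}) :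
  [disjoint A & B] ->
  perm_eq [seq F x | x in A :|: B] ([seq F x | x in A] ++ [seq F x | x in B]).
Proof.
move=> AB; rewrite /image_mem -map_cat; apply: perm_map.
apply: uniq_perm; rewrite ?cat_uniq ?enum_uniq ?andbT //=.
  apply/hasPn => x; rewrite !mem_enum => xB.
  by rewrite (disjointFl AB).
by move=> x; rewrite mem_cat !mem_enum inE.
Qed.

(** * Cycle lengths relative to an involution *)

Section Blocks.
Variables (T : finType) (b : T -> T).
Implicit Types (w : {perm T}) (C D : {set T}).

Definition selfcycles w : {set {set T}} := [set C in porbits w | b @: C == C].

(** Unions [C :|: b @: C] stand for the unordered pairs of [barpairs]: subsets of [T] are easier to
    transport along injections than sets of subsets. [barpair_block_lengths] reconciles the two. *)
Definition blocks w : {set {set T}} :=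
  [set C :|: b @: C | C in [set C in porbits w | b @: C != C]].

Definition self_lengths w : seq nat := [seq #|C|./2 | C in selfcycles w].

Definition block_lengths w : seq nat := [seq #|D|./2 | D in blocks w].

(* Discarding the 1s makes the type independent of n: for proper L of weight
   at most n, having type L^{up n} means having reduced type L. *)
Definition reduced_type (L : pairpart) w : bool :=
  perm_eq [seq l <- block_lengths w | l != 1] L.1 &&
  perm_eq (self_lengths w) L.2.

End Blocks.

(** * Cycles under an injection that intertwines two permutations *)

Section Equivariance.
Variables (T T' : finType) (b : T -> T) (b' : T' -> T') (G : T' -> T).
Hypotheses (injG : injective G) (bG : forall t, b (G t) = G (b' t)).
Variables (w : {perm T}) (w' : {perm T'}).
Hypothesis wG : forall t, w (G t) = G (w' t).

(** With [w' := w] and [G] the involution itself, this also says that the involution permutes the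
    cycles of [w]. *)
Lemma porbit_equivariant t : porbit w (G t) = G @: porbit w' t.
Proof.
have iterG i : (w ^+ i)%g (G t) = G ((w' ^+ i)%g t).
  by elim: i => [|i IH]; rewrite ?perm1 // !expgSr !permM IH wG.
apply/setP => p; apply/porbitP/imsetP => [[i ->]|[q /porbitP[i ->] ->]].
  by exists ((w' ^+ i)%g t); rewrite ?iterG // mem_porbit.
by exists i; rewrite iterG.
Qed.

Lemma imset_equivariant (C : {set T'}) : b @: (G @: C) = G @: (b' @: C).
Proof. by rewrite -!imset_comp; apply: eq_imset => t /=; rewrite bG. Qed.

Lemma porbits_equivariant (C : {set T}) : C \in porbits w ->
  ~~ [disjoint C & codom G] -> exists2 C', C' \in porbits w' & C = G @: C'.
Proof.
move=> /imsetP[p _ ->] /pred0Pn[q /andP[/= qp /codomP[t e]]].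
exists (porbit w' t); first exact: imset_f.
by rewrite -porbit_equivariant -e; apply/eqP; rewrite eq_sym eq_porbit_mem.
Qed.

Lemma codom_nondisjoint (C : {set T}) : C != set0 -> C \subset codom G ->
  ~~ [disjoint C & codom G].
Proof.
move=> /set0Pn[p pC] /subsetP CG; apply/pred0Pn; exists p.
by rewrite /= pC; apply: CG.
Qed.

Lemma porbit_neq0 (S : finType) (s : {perm S}) C : C \in porbits s -> C != set0.
Proof.
by move=> /imsetP[p _ ->]; apply/set0Pn; exists p; exact: porbit_id.
Qed.

Lemma imset_codom (C : {set T'}) : G @: C \subset codom G.
Proof. by apply/subsetP => p /imsetP[t _ ->]; exact: codom_f. Qed.

Lemma porbits_imset (C : {set T'}) : (C \in porbits w') = (G @: C \in porbits w).
Proof.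
apply/idP/idP => [/imsetP[t _ ->]|CG].
  by rewrite -porbit_equivariant; exact: imset_f.
have [|C' C'w /(imset_inj injG)->//] := porbits_equivariant CG.
by apply: codom_nondisjoint; [exact: porbit_neq0 CG|exact: imset_codom].
Qed.

Lemma selfcycles_equivariant :
  [set C in selfcycles b w | C \subset codom G]
  = [set G @: (C : {set T'}) | C in selfcycles b' w'].
Proof.
apply/setP => C; rewrite !inE; apply/idP/imsetP.
  case/andP=> /andP[Cw /eqP Cb] CG.
  have [|C' C'w eC] := porbits_equivariant Cw.
    by apply: codom_nondisjoint CG; exact: porbit_neq0 Cw.
  exists C' => //; rewrite inE C'w /=; apply/eqP/(imset_inj injG).
  by rewrite -imset_equivariant -eC.
case=> C'; rewrite inE => /andP[C'w /eqP C'b] ->.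
by rewrite -porbits_imset C'w imset_equivariant C'b eqxx imset_codom.
Qed.

Lemma blocks_equivariant :
  [set D in blocks b w | D \subset codom G]
  = [set G @: (D : {set T'}) | D in blocks b' w'].
Proof.
apply/setP => D; rewrite inE; apply/idP/imsetP.
  case/andP=> /imsetP[C]; rewrite inE => /andP[Cw Cb] ->.
  move=> /(subset_trans (subsetUl _ _)) CG.
  have [|C' C'w eC] := porbits_equivariant Cw.
    by apply: codom_nondisjoint CG; exact: porbit_neq0 Cw.
  exists (C' :|: b' @: C'); last by rewrite imsetU -imset_equivariant -eC.
  apply/imsetP; exists C' => //; rewrite inE C'w /=.
  by apply: contra Cb => /eqP e; rewrite eC imset_equivariant e.
case=> D' /imsetP[C']; rewrite inE => /andP[C'w C'b] -> ->.
rewrite imset_codom andbT imsetU -imset_equivariant; apply: imset_f.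
rewrite inE -porbits_imset C'w imset_equivariant.
by apply: contra C'b => /eqP/(imset_inj injG)->.
Qed.

End Equivariance.

(** * Extending a permutation by the identity *)

Section Lift.
Variables (T T' : finType) (G : T' -> T).
Hypothesis injG : injective G.

Definition lift_fun (w : {perm T'}) (p : T) : T :=
  if [pick t | G t == p] is Some t then G (w t) else p.

Lemma lift_funE w t : lift_fun w (G t) = G (w t).
Proof.
rewrite /lift_fun; case: pickP => [u /eqP/injG->//|/(_ t)].
by rewrite eqxx.
Qed.

Lemma lift_fun_out w p : p \notin codom G -> lift_fun w p = p.
Proof.
rewrite /lift_fun => pG; case: pickP => // t /eqP e.
by rewrite -e codom_f in pG.
Qed.

Lemma lift_fun_inj w : injective (lift_fun w).
Proof.
apply: (can_inj (g := lift_fun w^-1)) => p.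
case: (boolP (p \in codom G)) => [/codomP[t ->]|pG].
  by rewrite !lift_funE permK.
by rewrite !lift_fun_out.
Qed.

Definition lift_perm w : {perm T} := perm (@lift_fun_inj w).

Lemma lift_permE w t : lift_perm w (G t) = G (w t).
Proof. by rewrite permE lift_funE. Qed.

Lemma lift_perm_out w p : p \notin codom G -> lift_perm w p = p.
Proof. by rewrite permE; exact: lift_fun_out. Qed.

Lemma lift_permM w v : lift_perm (w * v)%g = (lift_perm w * lift_perm v)%g.
Proof.
apply/permP => p; rewrite permM.
case: (boolP (p \in codom G)) => [/codomP[t ->]|pG].
  by rewrite !lift_permE permM.
by rewrite !(lift_perm_out _ pG).
Qed.

Lemma lift_perm_inj : injective lift_perm.
Proof.
move=> w v e; apply/permP => t; apply: injG.
by rewrite -!lift_permE e.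
Qed.

Lemma lift_permP (w : {perm T}) : (forall p, p \notin codom G -> w p = p) ->
  exists v, w = lift_perm v.
Proof.
move=> fixw.
have wG t : w (G t) \in codom G.
  (* If [w (G t)] were outside the image, it would be fixed by [w]; injectivity then gives
     [w (G t) = G t], which is in the image. *)
  apply: contraT => /[dup] /fixw /perm_inj e; by rewrite e codom_f.
pose f t := iinv (wG t).
have fE t : G (f t) = w (G t) by exact: f_iinv.
have f_inj : injective f.
  by move=> t u e; apply/injG/(@perm_inj _ w); rewrite -!fE e.
exists (perm f_inj); apply/permP => p.
case: (boolP (p \in codom G)) => [/codomP[t ->]|pG].
  by rewrite lift_permE permE fE.
by rewrite lift_perm_out // fixw.
Qed.

Variables (b : T -> T) (b' : T' -> T').
Hypothesis bG : forall t, b (G t) = G (b' t).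
Hypothesis bfree : forall p, b p != p.
Hypothesis bb : involutive b.

Lemma codom_bar p : (b p \in codom G) = (p \in codom G).
Proof.
apply/codomP/codomP => -[t e]; exists (b' t); last by rewrite e bG.
by rewrite -bG -e bb.
Qed.

Lemma lift_perm_commute w : (forall p, lift_perm w (b p) = b (lift_perm w p))
  <-> (forall t, w (b' t) = b' (w t)).
Proof.
split=> [wb t|wb p].
  by apply: injG; rewrite -bG -!lift_permE -bG wb.
case: (boolP (p \in codom G)) => [/codomP[t ->]|pG].
  by rewrite bG !lift_permE bG wb.
by rewrite !lift_perm_out // codom_bar.
Qed.

Lemma porbit_fixed (S : finType) (s : {perm S}) p : s p = p -> porbit s p = [set p].
Proof.
move=> sp; apply/setP => q; rewrite inE; apply/porbitP/eqP => [[i ->]|->].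
  by elim: i => [|i IH]; rewrite ?perm1 // expgSr permM IH.
by exists 0; rewrite expg0 perm1.
Qed.

Lemma lift_porbits w C : C \in porbits (lift_perm w) ->
  C \subset codom G \/ exists p, C = [set p].
Proof.
move=> Cw; have [CG|] := boolP [disjoint C & codom G]; last first.
  case/(porbits_equivariant (lift_permE w) Cw) => C' _ ->.
  by left; exact: imset_codom.
right; have /imsetP[p _ e] := Cw; exists p; rewrite e; apply: porbit_fixed.
apply: lift_perm_out; rewrite (disjointFr CG) //.
by rewrite e porbit_id.
Qed.

(** The cycles created by the lift are singletons, and no singleton is stable under the
    fixed-point-free [b]. Hence no length has to be discarded here, in contrast to the blocks. *)
Lemma lift_self_lengths w :
  perm_eq (self_lengths b (lift_perm w)) (self_lengths b' w).
Proof.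
have e : selfcycles b (lift_perm w)
    = [set G @: (C : {set T'}) | C in selfcycles b' w].
  rewrite -(selfcycles_equivariant injG bG (lift_permE w)).
  apply/setP => C; rewrite [in RHS]inE; case: (boolP (C \in _)) => //=.
  rewrite inE => /andP[/lift_porbits[//|[p ->]]].
  by rewrite imset_set1 => /eqP/set1_inj/eqP; rewrite (negPf (bfree p)).
rewrite /self_lengths e.
apply: (perm_trans (perm_image_imset _ (in2W (imset_inj injG)))).
by rewrite /image_mem (eq_map (fun C : {set T'} => congr1 half (card_imset C injG))).
Qed.

Lemma lift_block_lengths w :
  perm_eq [seq l <- block_lengths b (lift_perm w) | l != 1]
          [seq l <- block_lengths b' w | l != 1].
Proof.
have filterE (S : finType) (A : {set {set S}}) :
    [seq l <- [seq #|D|./2 | D : {set S} in A] | l != 1]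
    = [seq #|D|./2 | D : {set S} in [set D in A | #|D|./2 != 1]].
  rewrite /image_mem filter_map; congr map.
  rewrite /enum_mem -filter_predI; apply: eq_filter => D.
  by rewrite /= !inE andbC.
rewrite /block_lengths !filterE.
have e : [set D in blocks b (lift_perm w) | #|D|./2 != 1]
    = [set G @: (D : {set T'}) | D in [set D in blocks b' w | #|D|./2 != 1]].
  apply/setP => D; rewrite inE; apply/idP/imsetP.
    case/andP=> Dw D1; have : D \in
      [set D in blocks b (lift_perm w) | D \subset codom G].
      rewrite inE Dw /=; move: Dw D1 => /imsetP[C].
      rewrite inE => /andP[/lift_porbits[CG _ -> _|[p -> _ ->]]].
        apply/subsetP => p; rewrite inE => /orP[|/imsetP[q qC ->]].
          exact: (subsetP CG).
        by rewrite codom_bar; apply: (subsetP CG).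
      (* The block of a new fixed point is [[set p; b p]], of half-size 1, which [D1] excludes. *)
      by rewrite imset_set1 cards2 [p == _]eq_sym bfree.
    rewrite (blocks_equivariant injG bG (lift_permE w)) => /imsetP[D' D'w eD].
    by exists D' => //; rewrite inE D'w -(card_imset D' injG) -eD.
  case=> D'; rewrite inE => /andP[D'w D'1] ->.
  rewrite card_imset // D'1 andbT.
  have : G @: D' \in [set G @: (D : {set T'}) | D in blocks b' w].
    exact: imset_f.
  rewrite -(blocks_equivariant injG bG (lift_permE w)) inE.
  by case/andP.
rewrite e.
apply: (perm_trans (perm_image_imset _ (in2W (imset_inj injG)))).
by rewrite /image_mem (eq_map (fun C : {set T'} => congr1 half (card_imset C injG))).
Qed.

Lemma lift_reduced_type L w :
  reduced_type b L (lift_perm w) = reduced_type b' L w.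
Proof.
rewrite /reduced_type; congr andb.
  exact: (permPl (lift_block_lengths w)).
exact: (permPl (lift_self_lengths w)).
Qed.

End Lift.

(** * Signed permutations of a finite set of pairs *)

Section Signed.
Variable X : finType.

(* Signed permutations of any finite set X of pairs act on X * bool, which
   allows changing the set of pairs along injections. *)
Definition flip (p : X * bool) : X * bool := (p.1, ~~ p.2).

Definition signed (w : {perm (X * bool)}) : bool :=
  [forall p, w (flip p) == flip (w p)].

(** For a signed [w] the two points of a pair are fixed together or not at all, so one of them is
    tested. A pair whose points are exchanged counts as moved, just as a part 1 of the second
    partition counts in the weight. *)
Definition moved (w : {perm (X * bool)}) : {set X} :=
  [set i | w (i, false) != (i, false)].

Lemma flipK : involutive flip.
Proof. by case=> i e; rewrite /flip /= negbK. Qed.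

Lemma flip_free p : flip p != p.
Proof. by case: p => i e; rewrite /flip xpair_eqE /= eqxx /=; case: e. Qed.

Lemma signedP (w : {perm (X * bool)}) :
  reflect (forall p, w (flip p) = flip (w p)) (signed w).
Proof. exact: 'forall_eqP. Qed.

(** [flip] exchanges the points of [D] with bit true and those with bit false. *)
Lemma even_card_flip (D : {set X * bool}) : flip @: D = D ->
  #|D| = (#|D|./2).*2.
Proof.
move=> fD; pose B := [set p : X * bool | p.2].
have e : D :\: B = flip @: (D :&: B).
  apply/setP => p; rewrite !inE; apply/andP/imsetP => [[pB pD]|[q]].
    exists (flip p); last by rewrite flipK.
    by rewrite !inE /= pB andbT -fD; apply: imset_f.
  rewrite !inE => /andP[qD qB] ->; rewrite /= qB; split=> //.
  by rewrite -fD imset_f.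
have -> : #|D| = (#|D :&: B|).*2.
  rewrite -(cardsID B D) e card_imset ?addnn //.
  exact: (can_inj flipK).
by rewrite doubleK.
Qed.

Variable w : {perm (X * bool)}.
Hypothesis signed_w : signed w.

Lemma porbit_flip p : flip @: porbit w p = porbit w (flip p).
Proof.
have wf := signedP _ signed_w.
by rewrite (porbit_equivariant (w' := w) (G := flip)).
Qed.

(* The orbits of the group generated by w and flip. *)
Let orb p := porbit w p :|: porbit w (flip p).

Lemma orb_eq p q : q \in orb p -> orb q = orb p.
Proof.
have aux r s : r \in porbit w s -> orb r = orb s.
  move=> rs; rewrite /orb -!porbit_flip.
  by have /eqP -> : porbit w r == porbit w s by rewrite eq_porbit_mem.
rewrite inE => /orP[/aux//|/aux->].
by rewrite /orb flipK setUC.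
Qed.

Lemma orbsE : [set orb p | p in [set: X * bool]] =
  selfcycles flip w :|: blocks flip w.
Proof.
apply/setP => D; apply/imsetP/setUP.
  case=> p _ ->; rewrite /orb -porbit_flip.
  have pw : porbit w p \in porbits w by exact: imset_f.
  case: (altP (flip @: porbit w p =P porbit w p)) => e.
    by left; rewrite e setUid inE pw e eqxx.
  by right; apply/imsetP; exists (porbit w p); rewrite // inE pw e.
case=> [|/imsetP[C]]; rewrite inE => /andP[/imsetP[p _ ->]].
  by move=> /eqP e; exists p; rewrite // /orb -porbit_flip e setUid.
by move=> _ ->; exists p; rewrite // /orb porbit_flip.
Qed.

Lemma selfcycles_blocks_disjoint : [disjoint selfcycles flip w & blocks flip w].
Proof.
apply/pred0P => D /=; apply/negbTE/negP => /andP[].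
rewrite inE => /andP[/imsetP[p _ ->] /eqP e] /imsetP[C].
rewrite inE => /andP[/imsetP[q _ ->] ne] eD.
have : q \in porbit w p by rewrite eD inE porbit_id.
rewrite -eq_porbit_mem => /eqP eq; case/negP: ne; apply/eqP.
by rewrite eq.
Qed.

(** The sets [orb p] are exactly the self-paired cycles and the blocks. They partition the
    [2 * #|X|] points, and each contributes half of its even size. *)
Lemma sumn_lengths :
  sumn (self_lengths flip w) + sumn (block_lengths flip w) = #|X|.
Proof.
pose Q := [set orb p | p in [set: X * bool]].
have -> : sumn (self_lengths flip w) + sumn (block_lengths flip w)
    = \sum_(D in Q) #|D|./2.
  rewrite /Q orbsE !sumnE !big_image /=.
  have disj := selfcycles_blocks_disjoint.
  rewrite big_mkcond [X in _ + X]big_mkcond [RHS]big_mkcond -big_split /=.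
  apply: eq_bigr => D _; rewrite in_setU.
  case: (boolP (D \in selfcycles flip w)) => Ds; last by rewrite add0n.
  by rewrite (disjointFr disj Ds) addn0.
have part : partition Q [set: X * bool].
  apply/and3P; split.
  - apply/eqP/setP => p; rewrite inE; apply/bigcupP; exists (orb p).
      exact: imset_f.
    by rewrite inE porbit_id.
  - apply/trivIsetP => _ _ /imsetP[p _ ->] /imsetP[q _ ->].
    apply: contraR => /pred0Pn[r /andP[/= rp rq]].
    by rewrite -(orb_eq rp) (orb_eq rq).
  - apply/imsetP => -[p _ e]; have : p \in orb p by rewrite inE porbit_id.
    by rewrite -e inE.
apply: double_inj; rewrite -[RHS]muln2 -[in RHS]card_bool -card_prod -cardsT.
rewrite (card_partition part) -mul2n big_distrr /=.
apply: eq_bigr => _ /imsetP[p _ ->]; rewrite mul2n -even_card_flip //.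
by rewrite /orb imsetU !porbit_flip flipK setUC.
Qed.

(** A block of length 1 has the form [[set p; flip p]] and contains [w p]. If [w p = p], the pair of
    [p] is not moved; if [w p = flip p], the cycle of [p] is self-paired and gives no block. *)
Lemma moved_full_lengths : moved w = [set: X] -> 1 \notin block_lengths flip w.
Proof.
move=> full; apply/negP => /imageP[D /imsetP[C]].
rewrite inE => /andP[/imsetP[p _ ->] ne] eD D1.
have wf := signedP _ signed_w.
have D2 : #|D| = 2.
  rewrite even_card_flip -?D1 // eD imsetU setUC -imset_comp.
  by rewrite (eq_imset (g := id)) ?imset_id // => q; rewrite /= flipK.
have : w p \in D by rewrite eD inE (mem_porbit w 1).
have /eqP <- : [set p; flip p] == D.
  rewrite eqEcard D2 cards2 [p == _]eq_sym flip_free andbT eD; apply/subsetP => q.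
  by rewrite !inE => /orP[] /eqP ->; rewrite ?porbit_id // porbit_flip porbit_id orbT.
rewrite !inE => /orP[] /eqP wp.
  have : p.1 \in moved w by rewrite full inE.
  rewrite inE; case: p wp {D eD D1 D2 ne} => i [] /= wp; last by rewrite wp eqxx.
  have -> : (i, false) = flip (i, true) by [].
  by rewrite wf wp eqxx.
case/negP: ne; rewrite porbit_flip eq_porbit_mem -wp.
exact: (mem_porbit w 1).
Qed.

End Signed.

(** * Changing the set of pairs along an injection *)

Section Index.
Variables (X X' : finType) (g : X' -> X).
Hypothesis injg : injective g.

Definition on_index (p : X' * bool) : X * bool := (g p.1, p.2).

Lemma on_index_inj : injective on_index.
Proof. by move=> [i e] [j f] [/injg -> ->]. Qed.

Lemma flip_on_index p : flip (on_index p) = on_index (flip p).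
Proof. by []. Qed.

Lemma codom_on_index p : (p \in codom on_index) = (p.1 \in codom g).
Proof.
apply/codomP/codomP => [[q ->]|[i e]]; first by exists q.1.
by exists (i, p.2); case: p e => ? ? /= ->.
Qed.

Definition lift_index := lift_perm on_index_inj.

Lemma lift_index_inj : injective lift_index.
Proof. exact: lift_perm_inj. Qed.

Lemma lift_indexM w v : lift_index (w * v)%g = (lift_index w * lift_index v)%g.
Proof. exact: lift_permM. Qed.

Lemma lift_index_signed w : signed (lift_index w) = signed w.
Proof.
by apply/signedP/signedP => /(lift_perm_commute on_index_inj flip_on_index
  (@flipK _)).
Qed.

Lemma lift_index_reduced_type L w :
  reduced_type (@flip X) L (lift_index w) = reduced_type (@flip X') L w.
Proof.
exact: (lift_reduced_type on_index_inj flip_on_index (@flip_free _) (@flipK _)).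
Qed.

Lemma moved_lift_index w : moved (lift_index w) = g @: moved w.
Proof.
apply/setP => i; rewrite inE; case: (boolP (i \in codom g)) => [/codomP[j ->]|ig].
  rewrite (mem_imset _ _ injg) inE.
  have -> : (g j, false) = on_index (j, false) by [].
  by rewrite lift_permE (inj_eq on_index_inj).
rewrite lift_perm_out ?codom_on_index // eqxx; apply/esym/negbTE.
by apply: contra ig => /imsetP[j _ ->]; exact: codom_f.
Qed.

Lemma lift_indexP (w : {perm (X * bool)}) : signed w -> moved w \subset codom g ->
  exists v, w = lift_index v.
Proof.
move=> /signedP wf /subsetP wg; apply: lift_permP => -[i e].
rewrite codom_on_index /= => ig.
have : i \notin moved w by apply: contra ig => /wg.
rewrite inE negbK => /eqP wi; case: e => //.
have -> : (i, true) = flip (i, false) by [].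
by rewrite wf wi.
Qed.

End Index.

(** The restriction of [w] to the pairs it moves has the same reduced type and moves every pair, so
    it has no block of length 1. The reduced type then lists all its lengths, whose sum is the
    number of pairs. *)
Lemma card_moved (X : finType) L (w : {perm (X * bool)}) :
  signed w -> reduced_type (@flip X) L w -> #|moved w| = wt L.
Proof.
move=> sw tw; pose Y : finType := {i | i \in moved w}.
have injv : injective (val : Y -> X) by exact: val_inj.
have [|v wv] := lift_indexP injv sw.
  by apply/subsetP => i iw; apply/codomP; exists (exist _ i iw).
have sv : signed v by rewrite -(lift_index_signed injv) -wv.
have tv : reduced_type (@flip Y) L v by rewrite -(lift_index_reduced_type injv) -wv.
have full : moved v = [set: Y].
  apply/setP => y; rewrite in_setT -(mem_imset _ _ injv) -moved_lift_index -wv.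
  exact: valP y.
have -> : #|moved w| = #|Y| by rewrite card_sig; apply: eq_card => i; rewrite !inE.
rewrite -(sumn_lengths sv); case/andP: tv => t1 t2.
rewrite (perm_sumn t2) /wt addnC -(perm_sumn t1); congr (sumn _ + _).
apply/esym/all_filterP/allP => l /=; apply: contraTneq => ->.
exact: moved_full_lengths.
Qed.

(** * Disjoint sums of signed permutations *)

Lemma inl_injective (A B : Type) : injective (@inl A B).
Proof. by move=> ? ? []. Qed.

Lemma inr_injective (A B : Type) : injective (@inr A B).
Proof. by move=> ? ? []. Qed.

Section Sum.
Variables (X1 X2 : finType) (w1 : {perm (X1 * bool)}) (w2 : {perm (X2 * bool)}).

Let G1 := on_index (@inl X1 X2).
Let G2 := on_index (@inr X1 X2).

Definition sum_perm : {perm (X1 + X2) * bool} :=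
  (lift_index (@inl_injective X1 X2) w1 * lift_index (@inr_injective X1 X2) w2)%g.

Lemma sum_perm_inl t : sum_perm (G1 t) = G1 (w1 t).
Proof.
rewrite permM lift_permE lift_perm_out // codom_on_index.
by apply/codomP => -[].
Qed.

Lemma sum_perm_inr t : sum_perm (G2 t) = G2 (w2 t).
Proof.
have e : lift_index (@inl_injective X1 X2) w1 (G2 t) = G2 t.
  by rewrite lift_perm_out // codom_on_index; apply/codomP => -[].
by rewrite permM e lift_permE.
Qed.

Lemma sum_perm_signed : signed w1 -> signed w2 -> signed sum_perm.
Proof.
move=> /signedP s1 /signedP s2; apply/signedP => -[[i|i] e].
  have -> : (inl i, e) = G1 (i, e) by [].
  by rewrite flip_on_index !sum_perm_inl s1.
have -> : (inr i, e) = G2 (i, e) by [].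
by rewrite flip_on_index !sum_perm_inr s2.
Qed.

Let injG1 : injective G1 := on_index_inj (@inl_injective X1 X2).
Let injG2 : injective G2 := on_index_inj (@inr_injective X1 X2).

Lemma sum_porbits C : C \in porbits sum_perm ->
  C \subset codom G1 \/ C \subset codom G2.
Proof.
case/imsetP => -[[i|i] e] _ ->; [left|right].
  have -> : (inl i, e) = G1 (i, e) by [].
  rewrite (porbit_equivariant sum_perm_inl).
  exact: imset_codom.
have -> : (inr i, e) = G2 (i, e) by [].
rewrite (porbit_equivariant sum_perm_inr).
exact: imset_codom.
Qed.

(** The family [A] is arbitrary so that the self-paired cycles and the blocks are both covered. *)
Lemma perm_sum_split (A : {set {set (X1 + X2) * bool}})
    (A1 : {set {set X1 * bool}}) (A2 : {set {set X2 * bool}}) :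
  [set C in A | C \subset codom G1] = [set G1 @: (C : {set _}) | C in A1] ->
  [set C in A | C \subset codom G2] = [set G2 @: (C : {set _}) | C in A2] ->
  (forall C, C \in A -> C != set0 /\ (C \subset codom G1 \/ C \subset codom G2)) ->
  perm_eq [seq #|C|./2 | C : {set _} in A]
    ([seq #|C|./2 | C : {set _} in A1] ++ [seq #|C|./2 | C : {set _} in A2]).
Proof.
move=> e1 e2 AG.
have -> : A = [set C in A | C \subset codom G1] :|: [set C in A | C \subset codom G2].
  apply/setP => C; rewrite !inE -andb_orr; case: (boolP (C \in A)) => //= CA.
  by apply/esym/orP; have [_] := AG _ CA.
apply: perm_trans (perm_image_setU _ _) _.
  apply/pred0P => C /=; apply/negbTE/negP; rewrite !inE.
  move=> /andP[/andP[CA C1] /andP[_ C2]].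
  have [/set0Pn[p pC] _] := AG _ CA.
  have /codomP[q1 e] := subsetP C1 _ pC; have /codomP[q2] := subsetP C2 _ pC.
  by rewrite e.
rewrite e1 e2; apply: perm_cat.
  apply: (perm_trans (perm_image_imset _ (in2W (imset_inj injG1)))).
  by rewrite /image_mem (eq_map (fun C : {set _} => congr1 half (card_imset C injG1))).
apply: (perm_trans (perm_image_imset _ (in2W (imset_inj injG2)))).
by rewrite /image_mem (eq_map (fun C : {set _} => congr1 half (card_imset C injG2))).
Qed.

Lemma sum_self_lengths : perm_eq (self_lengths (@flip _) sum_perm)
  (self_lengths (@flip _) w1 ++ self_lengths (@flip _) w2).
Proof.
apply: perm_sum_split.
- exact: (selfcycles_equivariant injG1 (flip_on_index _) sum_perm_inl).
- exact: (selfcycles_equivariant injG2 (flip_on_index _) sum_perm_inr).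
- move=> C; rewrite inE => /andP[Cw _]; split; first exact: porbit_neq0 Cw.
  exact: sum_porbits.
Qed.

Lemma sum_block_lengths : perm_eq (block_lengths (@flip _) sum_perm)
  (block_lengths (@flip _) w1 ++ block_lengths (@flip _) w2).
Proof.
apply: perm_sum_split.
- exact: (blocks_equivariant injG1 (flip_on_index _) sum_perm_inl).
- exact: (blocks_equivariant injG2 (flip_on_index _) sum_perm_inr).
- move=> _ /imsetP[C + ->]; rewrite inE => /andP[Cw _]; split.
    have /set0Pn[p pC] := porbit_neq0 Cw.
    by apply/set0Pn; exists p; rewrite inE pC.
  have [CG|CG] := sum_porbits Cw; [left|right]; apply/subsetP => p.
    rewrite inE => /orP[/(subsetP CG)//|/imsetP[q /(subsetP CG) + ->]].
    by rewrite !codom_on_index.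
  rewrite inE => /orP[/(subsetP CG)//|/imsetP[q /(subsetP CG) + ->]].
  by rewrite !codom_on_index.
Qed.

End Sum.

(** * Elements of a prescribed type *)

Section Cycle.
Variables (l : nat) (c : bool).

(* One cycle (a_1, .., a_j, bar a_1, .., bar a_j) if c, otherwise two. *)
Definition cycle_fun (p : 'I_l.+1 * bool) : 'I_l.+1 * bool :=
  (ordS p.1, p.2 (+) (c && (p.1 == ord_max))).

Lemma cycle_fun_inj : injective cycle_fun.
Proof.
move=> [i e] [j f] E; have /ordS_inj eij : ordS i = ordS j := congr1 fst E.
by have := congr1 snd E; rewrite /= eij => /addIb ->.
Qed.

Definition cycle_perm : {perm 'I_l.+1 * bool} := perm cycle_fun_inj.

Lemma cycle_perm_signed : signed cycle_perm.
Proof. by apply/signedP => p; rewrite !permE /cycle_fun /flip /= addNb. Qed.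

(** The bit can change only on leaving [ord_max], that is at step [l.+1]; up to step [l] the two
    values of [c] behave alike. *)
Lemma cycle_perm_iter e k : k <= l ->
  (cycle_perm ^+ k)%g (ord0, e) = (inord k, e).
Proof.
elim: k => [|k IH] kl.
  by rewrite perm1; congr pair; apply/val_inj; rewrite /= inordK.
rewrite expgSr permM (IH (ltnW kl)) permE /cycle_fun /=.
have ne : (inord k == ord_max :> 'I_l.+1) = false.
  by apply/negbTE; rewrite -val_eqE /= inordK ?(ltn_eqF kl) // ltnW.
rewrite ne andbF addbF; congr pair; apply/val_inj.
by rewrite /= !inordK ?modn_small // ltnW.
Qed.

Lemma porbit_cycle_perm i e : (i, e) \in porbit cycle_perm (ord0, e).
Proof.
apply/porbitP; exists i; rewrite cycle_perm_iter ?inord_val //.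
by rewrite -ltnS.
Qed.

End Cycle.

Lemma image_set1 (S : finType) (F : S -> nat) (x : S) :
  [seq F y | y in [set x]] = [:: F x].
Proof. by rewrite /image_mem enum_set1. Qed.

Lemma image_set0 (S : finType) (F : S -> nat) (A : {set S}) :
  A = set0 -> [seq F y | y in A] = [::].
Proof. by move=> ->; rewrite /image_mem enum_set0. Qed.

Lemma twisted_cycle_lengths l :
  self_lengths (@flip _) (cycle_perm l true) = [:: l.+1]
  /\ block_lengths (@flip _) (cycle_perm l true) = [::].
Proof.
set w := cycle_perm l true.
have po p : porbit w p = setT.
  have half e : porbit w (ord0, e) = porbit w (ord0, false).
    case: e => //; apply/eqP; rewrite eq_porbit_mem.
    (* The wrap from [ord_max] to [ord0] changes the bit, so a single cycle runs through all
       points. *)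
    have e : w (ord_max, false) = (ord0, true).
      by rewrite permE /cycle_fun /= eqxx; congr pair; apply/val_inj; rewrite /= modnn.
    have em : porbit w (ord_max, false) = porbit w (ord0, false).
      by apply/eqP; rewrite eq_porbit_mem porbit_cycle_perm.
    by have := mem_porbit w 1 (ord_max, false); rewrite expg1 e em.
  have all q : q \in porbit w (ord0, false).
    by case: q => i e; rewrite -(half e) porbit_cycle_perm.
  have /eqP -> : porbit w p == porbit w (ord0, false) by rewrite eq_porbit_mem.
  by apply/setP => q; rewrite all inE.
have flipT : @flip _ @: [set: 'I_l.+1 * bool] = setT.
  apply/setP => p; rewrite [RHS]inE; apply/imsetP.
  by exists (flip p); rewrite ?inE // flipK.
have pos : porbits w = [set setT].
  apply/setP => C; rewrite inE; apply/imsetP/eqP => [[p _ ->]|->]; first exact: po.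
  by exists (ord0, false); rewrite // po.
have sc : selfcycles (@flip _) w = [set setT].
  apply/setP => C; rewrite inE pos !inE.
  by case: eqP => // ->; rewrite flipT eqxx.
rewrite /self_lengths sc image_set1 cardsT card_prod card_ord card_bool muln2 doubleK; split=> //.
apply: image_set0; apply/setP => D; rewrite in_set0; apply/negbTE/imsetP.
by case=> C; rewrite inE pos inE => /andP[/eqP ->]; rewrite flipT eqxx.
Qed.

(** Without the twist the bit is invariant: each bit carries one cycle, and [flip] exchanges the
    two. *)
Lemma split_cycle_lengths l :
  self_lengths (@flip _) (cycle_perm l false) = [::]
  /\ block_lengths (@flip _) (cycle_perm l false) = [:: l.+1].
Proof.
set w := cycle_perm l false.
have po p : porbit w p = [set q | q.2 == p.2].
  case: p => i e; have /eqP -> : porbit w (i, e) == porbit w (ord0, e).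
    by rewrite eq_porbit_mem porbit_cycle_perm.
  apply/setP => -[j f]; rewrite inE /=; apply/idP/eqP => [/porbitP[k]|->].
    suff: ((w ^+ k)%g (ord0, e)).2 = e by move=> + eq; rewrite -eq.
    by elim: k => [|k IH]; rewrite ?perm1 // expgSr permM permE /= addbF.
  exact: porbit_cycle_perm.
have flip_po p : @flip _ @: porbit w p = porbit w (flip p).
  exact: (porbit_flip (cycle_perm_signed l false)).
have ne p : porbit w (flip p) != porbit w p.
  by rewrite eq_porbit_mem po inE /=; case: (p.2).
split.
  apply: image_set0; apply/setP => C; rewrite in_set0; apply/negbTE/negP.
  by rewrite inE => /andP[/imsetP[p _ ->]]; rewrite flip_po (negPf (ne p)).
have un p : porbit w p :|: porbit w (flip p) = setT.
  by apply/setP => q; rewrite !po !inE /=; case: (q.2) (p.2) => [] [].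
have bl : blocks (@flip _) w = [set setT].
  apply/setP => D; rewrite inE; apply/imsetP/eqP => [[C]|->].
    by rewrite inE => /andP[/imsetP[p _ ->] _] ->; rewrite flip_po un.
  exists (porbit w (ord0, false)); last by rewrite flip_po un.
  by rewrite inE flip_po ne andbT; exact: imset_f.
by rewrite /block_lengths bl image_set1 cardsT card_prod card_ord card_bool muln2 doubleK.
Qed.

(** Each part [m.+1] contributes one summand on [m.+1] new pairs, twisted for [d] and split for [l],
    starting from the empty set of pairs. *)
Lemma exists_signed (l d : seq nat) : 0 \notin l -> 0 \notin d ->
  exists (X : finType) (w : {perm X * bool}),
    [/\ signed w, perm_eq (block_lengths (@flip _) w) l
      & perm_eq (self_lengths (@flip _) w) d].
Proof.
elim: l => [_|[//|m] l IH]; last first.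
  rewrite inE /= => l0 /(IH l0)[X [w [sw bw selfw]]].
  have [cs cb] := split_cycle_lengths m.
  exists ('I_m.+1 + X)%type, (sum_perm (cycle_perm m false) w); split.
  - exact: sum_perm_signed (cycle_perm_signed _ _) sw.
  - apply: perm_trans (sum_block_lengths _ _) _.
    by rewrite cb /= perm_cons.
  - apply: perm_trans (sum_self_lengths _ _) _.
    by rewrite cs.
elim: d => [_|[//|m] d IH].
  exists void, 1%g; split.
  - by apply/signedP => -[].
  - rewrite /block_lengths image_set0 //; apply/setP => D.
    rewrite in_set0; apply/negbTE/imsetP => -[C].
    by rewrite inE => /andP[/imsetP[[[]]]].
  - rewrite /self_lengths image_set0 //; apply/setP => C.
    by rewrite in_set0; apply/negbTE; rewrite inE; apply/negP => /andP[/imsetP[[[]]]].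
rewrite inE /= => /IH[X [w [sw bw selfw]]].
have [cs cb] := twisted_cycle_lengths m.
exists ('I_m.+1 + X)%type, (sum_perm (cycle_perm m true) w); split.
- exact: sum_perm_signed (cycle_perm_signed _ _) sw.
- by apply: perm_trans (sum_block_lengths _ _) _; rewrite cb.
- apply: perm_trans (sum_self_lengths _ _) _.
  by rewrite cs /= perm_cons.
Qed.

Lemma exists_reduced_type (K : pairpart) : proper_pair K ->
  exists (X : finType) (w : {perm X * bool}),
    [/\ signed w, reduced_type (@flip _) K w & #|X| = wt K].
Proof.
move=> K1; have /andP[_ l0] := partsP K.1; have /andP[_ d0] := partsP K.2.
have [X [w [sw bw selfw]]] := exists_signed l0 d0.
exists X, w; split=> //; last first.
  by rewrite -(sumn_lengths sw) (perm_sumn bw) (perm_sumn selfw) addnC.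
rewrite /reduced_type selfw andbT.
suff -> : [seq l <- block_lengths (@flip _) w | l != 1] = block_lengths (@flip _) w.
  by [].
apply/all_filterP/allP => l; rewrite (perm_mem bw) => lK.
by apply: contraNneq K1 => <-.
Qed.

(** * Counting factorizations by their support *)

Section Counting.
Variables L M : pairpart.

Definition factorizations (X : finType) (z : {perm X * bool}) :
    {set {perm X * bool} * {perm X * bool}} :=
  [set p | [&& signed p.1, signed p.2, reduced_type (@flip X) L p.1,
               reduced_type (@flip X) M p.2 & (p.1 * p.2)%g == z]].

Definition moved2 (X : finType) (p : {perm X * bool} * {perm X * bool}) : {set X} :=
  moved p.1 :|: moved p.2.

Lemma movedM (X : finType) (x y : {perm X * bool}) :
  moved (x * y)%g \subset moved x :|: moved y.
Proof.
apply/subsetP => i; apply: contraTT; rewrite !inE permM negb_or !negbK.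
by case/andP=> /eqP -> /eqP ->.
Qed.

Definition full_factorizations (X : finType) (z : {perm X * bool}) :=
  [set p in factorizations z | moved2 p == setT].

(** Two permutations that move only pairs in the image of [g] are lifts of unique permutations over
    [Y], and lifting respects products and reduced types. This is the relabelling that frees the
    counts from the ambient set. *)
Lemma factorizations_lift (X Y : finType) (g : Y -> X) (injg : injective g)
    (z : {perm Y * bool}) :
  #|[set p in factorizations (lift_index injg z) | moved2 p == g @: setT]|
  = #|full_factorizations z|.
Proof.
pose f (p : {perm Y * bool} * {perm Y * bool}) :=
  (lift_index injg p.1, lift_index injg p.2).
have injf : injective f.
  move=> [x y] [x' y'] [].
  by move=> /lift_index_inj -> /lift_index_inj ->.
have fE p : (f p \in factorizations (lift_index injg z)) = (p \in factorizations z).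
  rewrite !inE /= !lift_index_signed !lift_index_reduced_type -lift_indexM.
  by rewrite (inj_eq (@lift_index_inj _ _ _ _)).
have fM p : moved2 (f p) = g @: moved2 p.
  by rewrite /moved2 !moved_lift_index imsetU.
rewrite -(card_imset _ injf); apply: eq_card => -[x y]; rewrite inE.
apply/andP/imsetP => [[xy /eqP m]|[q]].
  have codomE : g @: [set: Y] = [set i | i \in codom g].
    apply/setP => i; rewrite inE; apply/imsetP/codomP => [[j _ ->]|[j ->]];
    by exists j.
  have mg : moved2 (x, y) \subset codom g by rewrite m; exact: imset_codom.
  have /and5P[sx sy _ _ _] : [&& signed x, signed y, reduced_type (@flip X) L x,
     reduced_type (@flip X) M y & (x * y)%g == lift_index injg z].
    by move: xy; rewrite inE.
  have [x' ex] := lift_indexP injg sx (subset_trans (subsetUl _ _) mg).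
  have [y' ey] := lift_indexP injg sy (subset_trans (subsetUr _ _) mg).
  exists (x', y'); last by rewrite ex ey.
  rewrite /full_factorizations inE -fE {1}/f /= -ex -ey xy /=.
  by rewrite -(inj_eq (imset_inj injg)) -fM /f /= -ex -ey m.
rewrite inE => /andP[qz /eqP mq] ->; split; first by rewrite fE.
by rewrite fM mq.
Qed.

Lemma lift_index_comp (X Y Z : finType) (h : Z -> X) (g : Y -> X) (k : Z -> Y)
    (injh : injective h) (injg : injective g) (injk : injective k) z :
  (forall i, h i = g (k i)) ->
  lift_index injh z = lift_index injg (lift_index injk z).
Proof.
move=> hgk; apply/permP => p.
have hE t : on_index h t = on_index g (on_index k t) by rewrite /on_index hgk.
case: (boolP (p \in codom (on_index g))) => [/codomP[t ->]|pg]; last first.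
  rewrite !lift_perm_out //; apply: contra pg => /codomP[t ->].
  by rewrite hE codom_f.
rewrite [RHS]lift_permE.
case: (boolP (t \in codom (on_index k))) => [/codomP[s ->]|tk].
  by rewrite -hE !lift_permE hE.
rewrite !lift_perm_out //; apply: contra tk => /codomP[s].
by rewrite hE => /(on_index_inj injg) ->; exact: codom_f.
Qed.

Variables (Z : finType) (z : {perm Z * bool}).
Hypothesis full_z : moved z = setT.

(** The number a_k, counted on the reference set made of [Z] and [k] further pairs; no [n] occurs in
    it. *)
Definition full_count (k : nat) : nat :=
  #|full_factorizations (lift_index (@inl_injective Z 'I_k) z)|.

Lemma factorizations_moved (X : finType) (h : Z -> X) (injh : injective h)
    (V : {set X}) :
  V \subset ~: (h @: setT) ->
  #|[set p in factorizations (lift_index injh z) | moved2 p :\: h @: setT == V]|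
  = full_count #|V|.
Proof.
move=> VH; set H := h @: setT in VH *.
(* [g] identifies the reference set with [H :|: V] by numbering the pairs of [V]. *)
pose g (i : Z + 'I_#|V|) : X :=
  match i with inl j => h j | inr j => enum_val j end.
have hV i : (h i \in V) = false.
  apply/negbTE/negP => /(subsetP VH); rewrite inE => /negP; apply.
  exact: imset_f.
have injg : injective g.
  move=> [i|i] [j|j] /= e.
  - by rewrite (injh _ _ e).
  - by have := hV i; rewrite e enum_valP.
  - by have := hV j; rewrite -e enum_valP.
  - by rewrite (enum_val_inj e).
have gT : g @: setT = H :|: V.
  apply/setP => i; rewrite inE; apply/imsetP/orP => [[[j|j] _ ->]|[/imsetP[j _ ->]|iV]].
  - by left; exact: imset_f.
  - by right; exact: enum_valP.
  - by exists (inl j).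
  - by exists (inr (enum_rank_in iV i)); rewrite //= enum_rankK_in.
rewrite (@lift_index_comp _ _ _ _ g inl injh injg (@inl_injective _ _)) //.
rewrite /full_count -(factorizations_lift injg) gT.
apply: eq_card => p; rewrite [LHS]inE [RHS]inE; apply: andb_id2l.
rewrite inE => /and5P[_ _ _ _ /eqP pz].
(* The product moves every pair of [H], so one of the two factors does. Hence [moved2 p] contains
   [H] and is determined by its difference with [H]. *)
have Hp : H \subset moved2 p.
  apply: subset_trans (movedM p.1 p.2); rewrite pz.
  by rewrite !moved_lift_index full_z -imset_comp.
apply/eqP/eqP => [<-|->].
  by rewrite setDE setUIr setUCr setIT; apply/esym/setUidPr.
apply/setP => i; rewrite !inE; case: (boolP (i \in V)) => [iV|_].
  by rewrite orbT andbT; have := subsetP VH _ iV; rewrite inE.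
by rewrite orbF andNb.
Qed.

(** Factorizations are sorted by the set [V] of moved pairs outside [H], and these sets by their
    size [k], since only the size of [V] affects the count. *)
Lemma card_factorizations (X : finType) (h : Z -> X) (injh : injective h) :
  #|factorizations (lift_index injh z)|
  = \sum_(k < (#|X| - #|Z|).+1) 'C(#|X| - #|Z|, k) * full_count k.
Proof.
set H := h @: setT.
have cH : #|~: H| = #|X| - #|Z|.
  by rewrite cardsCs setCK /H card_imset // cardsT.
rewrite -sum1_card (partition_big (fun p => moved2 p :\: H)
  (fun V => V \subset ~: H)) /=; last first.
  by move=> p _; rewrite setDE subsetIr.
rewrite (eq_bigr (fun V : {set X} => full_count #|V|)); last first.
  move=> V VH; rewrite -(factorizations_moved injh VH) -sum1_card.
  by apply: eq_bigl => p; rewrite !inE.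
(* [inord] does not truncate here: [V] lies in [~: H], so its size is within the index range. *)
rewrite -cH (partition_big (fun V : {set X} => inord #|V| : 'I_#|~: H|.+1) predT) //=.
apply: eq_bigr => k _.
rewrite -(cards_draws (~: H) k) -sum_nat_const.
rewrite [RHS](eq_bigr (fun V : {set X} => full_count #|V|)); last first.
  by move=> V; rewrite inE => /andP[_ /eqP ->].
apply: eq_bigl => V; rewrite inE; apply: andb_id2l => VH.
by rewrite -val_eqE /= inordK // ltnS subset_leq_card.
Qed.

Lemma full_count_eq0 k : wt L + wt M < #|Z| + k -> full_count k = 0.
Proof.
apply: contraTeq; rewrite -leqNgt -lt0n card_gt0 => /set0Pn[p].
rewrite 2!inE => /andP[/and5P[s1 s2 t1 t2 _] /eqP full].
have <- : #|moved2 p| = #|Z| + k by rewrite full cardsT card_sum card_ord.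
by rewrite -(card_moved s1 t1) -(card_moved s2 t2) leq_card_setU.
Qed.

End Counting.

(** * Signed permutations as elements of the hyperoctahedral group *)

Section Points.
Variable n : nat.

Lemma point_subproof (p : 'I_n * bool) : p.1.*2 + p.2 < n.*2.
Proof.
case: p => i e /=; have : i.*2.+1 < n.*2 by rewrite -doubleS leq_double ltn_ord.
by case: e => /=; rewrite ?addn1 ?addn0 // => /ltnW.
Qed.

Definition point (p : 'I_n * bool) : 'I_(n.*2) := Ordinal (point_subproof p).

Lemma half_point p : (point p)./2 = p.1.
Proof. by rewrite /= addnC half_bit_double. Qed.

Lemma odd_point p : odd (point p) = p.2.
Proof. by case: p => i e; rewrite /= oddD odd_double oddb. Qed.

Lemma point_inj : injective point.
Proof.
move=> p q e; have := half_point p; have := odd_point p.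
rewrite e odd_point half_point; case: p q {e} => i e [j f] /= -> /ord_inj ->.
by [].
Qed.

Lemma codom_point a : a \in codom point.
Proof.
have an : a./2 < n by rewrite ltn_half_double.
apply/codomP; exists (Ordinal an, odd a); apply/val_inj.
by rewrite /= addnC odd_double_half.
Qed.

Lemma bar_point p : bar (point p) = point (flip p).
Proof.
case: p => i e; apply/val_inj; rewrite /= oddD odd_double oddb.
by case: e; rewrite /= ?addn1 ?addn0.
Qed.

Lemma barK : involutive (@bar n).
Proof.
by move=> a; have /codomP[p ->] := codom_point a; rewrite !bar_point flipK.
Qed.

Lemma bar_free (a : 'I_(n.*2)) : bar a != a.
Proof.
have /codomP[p ->] := codom_point a.
by rewrite bar_point (inj_eq point_inj) flip_free.
Qed.

Lemma mem_pairset (a : 'I_(n.*2)) i : (a \in pairset i) = (a./2 == i :> nat).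
Proof.
have /codomP[[j e] ->] := codom_point a; rewrite half_point inE /=.
by case: e; rewrite ?addn1 ?addn0 ?eqSS ?(inj_eq double_inj) ?orbF //;
  [rewrite orbC|]; case: eqP => //= _; apply/eqP => /(congr1 odd);
  rewrite /= ?oddS !odd_double.
Qed.

Lemma pairsetE (i : 'I_n) (a : 'I_(n.*2)) : a \in pairset i ->
  pairset i = [set a; bar a].
Proof.
rewrite mem_pairset; have /codomP[[j e] ->] := codom_point a.
rewrite half_point /= => /eqP/ord_inj <-.
apply/setP => c; have /codomP[[k f] ->] := codom_point c.
rewrite mem_pairset half_point !inE bar_point !(inj_eq point_inj) /flip /=.
rewrite !xpair_eqE val_eqE -andb_orr; case: (k == j) => //=.
by case: e f => [] [].
Qed.

(** When [w] maps pairs onto pairs, [w (bar a)] lies in the pair of [w a] and differs from [w a],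
    which leaves only [bar (w a)]. *)
Lemma hyperoctP (w : 'S_(n.*2)) :
  reflect (forall a, w (bar a) = bar (w a)) (w \in hyperoct n).
Proof.
rewrite inE; apply: (iffP forallP) => [wp a|wb i].
  have an : a./2 < n by rewrite ltn_half_double.
  have ai : a \in pairset (Ordinal an) by rewrite mem_pairset.
  have /existsP[j /eqP wj] := wp (Ordinal an).
  have wa : w a \in pairset j by rewrite -wj imset_f.
  have : w (bar a) \in pairset j.
    by rewrite -wj imset_f // (pairsetE ai) !inE eqxx orbT.
  rewrite (pairsetE wa) !inE (inj_eq perm_inj) (negPf (bar_free a)) /=.
  by move/eqP.
pose a := point (i, false).
have ai : a \in pairset i by rewrite mem_pairset half_point.
have wn : (w a)./2 < n by rewrite ltn_half_double.
have wai : w a \in pairset (Ordinal wn) by rewrite mem_pairset.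
apply/existsP; exists (Ordinal wn); rewrite (pairsetE ai) (pairsetE wai).
by rewrite imsetU1 imset_set1 wb.
Qed.

(** Replacing a pair of cycles by its union loses nothing: cycles are disjoint, so the union
    determines the two cycles. *)
Lemma barpair_block_lengths (w : 'S_(n.*2)) : w \in hyperoct n ->
  perm_eq (barpair_lengths w) (block_lengths (@bar n) w).
Proof.
move=> /hyperoctP wb.
have coverE (C : {set 'I_(n.*2)}) :
    finset.cover [set C; @bar n @: C] = C :|: @bar n @: C.
  by rewrite /finset.cover bigcup_setU !big_set1.
have -> : block_lengths (@bar n) w =
  [seq #|D|./2 | D : {set 'I_(n.*2)} in
     @finset.cover 'I_(n.*2) @: barpairs w].
  rewrite /block_lengths /blocks /barpairs -imset_comp.
  by under [in RHS]eq_imset do rewrite /= coverE.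
rewrite perm_sym; apply: perm_image_imset.
have sub (C C' : {set 'I_(n.*2)}) : C \in porbits w -> C' \in porbits w ->
    C :|: @bar n @: C = C' :|: @bar n @: C' ->
    C = C' \/ C = @bar n @: C'.
  move=> /imsetP[p _ ->] /imsetP[q _ ->] e.
  have barq : @bar n @: porbit w q = porbit w (bar q).
    by rewrite (porbit_equivariant (w' := w) (G := @bar n)).
  have : p \in porbit w q :|: @bar n @: porbit w q by rewrite -e inE porbit_id.
  by rewrite barq inE -!eq_porbit_mem => /orP[] /eqP; [left|right].
move=> P P' /imsetP[C + ->] /imsetP[C' + ->].
rewrite !inE !coverE => /andP[Cw _] /andP[C'w _] /(sub _ _ Cw C'w) [->//|->].
rewrite -imset_comp (eq_imset (g := id)) ?imset_id; last by move=> a /=; rewrite barK.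
by rewrite setUC.
Qed.

(** [point] is onto, so this lift is a bijective transport, and the lemmas on lifts apply to it. *)
Definition to_hyperoct : {perm 'I_n * bool} -> 'S_(n.*2) := lift_perm point_inj.

Lemma to_hyperoctP w : exists v, w = to_hyperoct v.
Proof. by apply: lift_permP => a; rewrite codom_point. Qed.

Lemma to_hyperoct_inj : injective to_hyperoct.
Proof. exact: lift_perm_inj. Qed.

Lemma to_hyperoctM v w : to_hyperoct (v * w)%g = (to_hyperoct v * to_hyperoct w)%g.
Proof. exact: lift_permM. Qed.

Lemma mem_hyperoct v : (to_hyperoct v \in hyperoct n) = signed v.
Proof.
by apply/hyperoctP/signedP => /(lift_perm_commute point_inj bar_point barK).
Qed.

Lemma to_hyperoct_block_lengths v :
  perm_eq (block_lengths (@bar n) (to_hyperoct v)) (block_lengths (@flip _) v).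
Proof.
have := blocks_equivariant point_inj bar_point (lift_permE point_inj v).
have -> : [set D in blocks (@bar n) (to_hyperoct v) | D \subset codom point]
    = blocks (@bar n) (to_hyperoct v).
  apply/setP => D; rewrite in_set andb_idr // => _.
  by apply/subsetP => a _; exact: codom_point.
rewrite /block_lengths => ->.
apply: (perm_trans (perm_image_imset _ (in2W (imset_inj point_inj)))).
by rewrite /image_mem (eq_map (fun C : {set _} => congr1 half (card_imset C point_inj))).
Qed.

(** The type and the reduced type differ only in the number of 1s, and that number is forced: all
    lengths sum to [n], which leaves exactly [n - wt L] of them equal to 1. *)
Lemma mem_Hset (L : pairpart) v : proper_pair L -> wt L <= n ->
  (to_hyperoct v \in Hset n (up1 n L) L.2) = signed v && reduced_type (@flip _) L v.
Proof.
move=> L1 Ln; rewrite inE; case: (boolP (signed v)) => sv; last first.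
  by rewrite -mem_hyperoct in sv; rewrite (negPf sv).
have hv : to_hyperoct v \in hyperoct n by rewrite mem_hyperoct.
rewrite hv /has_type /reduced_type /=.
rewrite (permPl (barpair_block_lengths hv)) (permPl (to_hyperoct_block_lengths v)).
rewrite (permPl (lift_self_lengths point_inj bar_point bar_free v)).
apply: andb_id2r => tS; have := sumn_lengths sv; rewrite card_ord (perm_sumn tS).
set B := block_lengths _ v => sB.
have L1f : [seq l <- L.1 : seq nat | l != 1] = L.1.
  by apply/all_filterP/allP => l lL; apply: contraNneq L1 => <-.
apply/idP/idP => [/(perm_filter (predC1 1))|tB].
  move=> h; apply: (perm_trans h); rewrite filter_cat L1f -[X in perm_eq _ X]cats0.
  by rewrite perm_cat2l filter_nseq.
have eB : perm_eq B (L.1 ++ [seq l <- B | l == 1]).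
  by rewrite -(perm_filterC (pred1 1) B) perm_catC perm_cat2r.
apply: (perm_trans eB); rewrite /up1.
have ones : [seq l <- B | l == 1] = nseq (size [seq l <- B | l == 1]) 1.
  by apply/all_pred1P/filter_all.
rewrite ones; set k := size _; suff -> : n - wt L = k by [].
rewrite -sB (perm_sumn eB) ones sumn_cat sumn_nseq mul1n addnA [X in X + k - _]addnC.
by rewrite -/(wt L) addKn.
Qed.

End Points.

(** * Transfer to the conjugacy classes *)

Lemma card_pairs_Hset (n : nat) (L M : pairpart) (v : {perm 'I_n * bool}) :
  proper_pair L -> proper_pair M -> wt L <= n -> wt M <= n ->
  #|[set p : 'S_(n.*2) * 'S_(n.*2) | [&& p.1 \in Hset n (up1 n L) L.2,
     p.2 \in Hset n (up1 n M) M.2 & (p.1 * p.2)%g == to_hyperoct v]]|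
  = #|factorizations L M v|.
Proof.
move=> L1 M1 Ln Mn.
pose f (p : {perm 'I_n * bool} * {perm 'I_n * bool}) :=
  (to_hyperoct p.1, to_hyperoct p.2).
have injf : injective f.
  by move=> [x y] [x' y'] [/to_hyperoct_inj -> /to_hyperoct_inj ->].
rewrite -(card_imset _ injf); apply: eq_card => -[x y].
have [x' ->] := to_hyperoctP x; have [y' ->] := to_hyperoctP y.
rewrite -/(f (x', y')) (mem_imset _ _ injf) [LHS]in_set [RHS]in_set /=.
rewrite !mem_Hset // -to_hyperoctM (inj_eq (@to_hyperoct_inj n)).
by case: (signed x'); case: (signed y'); rewrite ?andbF.
Qed.

Lemma partition_perm_inj (s t : Defs.partition) : perm_eq s t -> s = t.
Proof.
move=> st; apply/val_inj; apply: (sorted_eq (leT := geq)) => //.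
- by move=> a b c /= ba cb; apply: leq_trans cb ba.
- by move=> a b; rewrite /= andbC -eqn_leq => /eqP.
- by have /andP[] := partsP s.
- by have /andP[] := partsP t.
Qed.

Lemma reduced_type_inj (T : finType) (b : T -> T) (w : {perm T}) K K' :
  reduced_type b K w -> reduced_type b K' w -> K = K'.
Proof.
case: K K' => [r s] [r' s'] /andP[/= tr ts] /andP[/= tr' ts']; congr pair.
  by apply: partition_perm_inj; rewrite -(permPl tr).
by apply: partition_perm_inj; rewrite -(permPl ts).
Qed.

Lemma Hset_inj n K K' (w : 'S_(n.*2)) : proper_pair K -> proper_pair K' ->
  wt K <= n -> wt K' <= n ->
  w \in Hset n (up1 n K) K.2 -> w \in Hset n (up1 n K') K'.2 -> K = K'.
Proof.
move=> pK pK' Kn K'n; have [v ->] := to_hyperoctP w.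
rewrite !mem_Hset // => /andP[_ t] /andP[_ t'].
exact: reduced_type_inj t t'.
Qed.

(** A single [z] serves every [n], and only the embedding [h] varies; this gives one polynomial for
    all [n]. It moves every pair of [Z] because by [card_moved] it moves [wt K] of them. *)
Lemma exists_lift_Hset (K : pairpart) : proper_pair K ->
  exists (Z : finType) (z : {perm Z * bool}), [/\ moved z = setT, #|Z| = wt K &
    forall n, wt K <= n -> exists (h : Z -> 'I_n) (injh : injective h),
      to_hyperoct (lift_index injh z) \in Hset n (up1 n K) K.2].
Proof.
move=> pK; have [Z [z [sz tz cZ]]] := exists_reduced_type pK.
exists Z, z; split=> //.
  by apply/eqP; rewrite eqEcard subsetT cardsT cZ (card_moved sz tz) leqnn.
move=> n Kn; have Zn : #|Z| <= n by rewrite cZ.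
have injh : injective (fun i : Z => widen_ord Zn (enum_rank i)).
  by move=> i j /(congr1 val) /= /ord_inj/enum_rank_inj.
exists _, injh; rewrite mem_Hset //.
by rewrite lift_index_signed lift_index_reduced_type sz.
Qed.

(** * Coefficients in the group algebra *)

Lemma gring_proj_gset (F : fieldType) (gT : finGroupType) (G : {group gT})
    (A : {set gT}) (x : gT) : A \subset G -> x \in G ->
  gring_proj x (gset_mx F G A) = (x \in A)%:R%R.
Proof.
move=> /subsetP AG Gx; rewrite /gset_mx linear_sum /=.
rewrite (eq_bigr (fun y => (x == y)%:R%R)); last first.
  by move=> y yA; rewrite gring_projE // AG.
case: (boolP (x \in A)) => xA.
  rewrite (bigD1 x) //= eqxx big1 ?addr0 // => y /andP[_].
  by rewrite eq_sym => /negPf ->.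
by rewrite big1 // => y yA; case: eqP => // e; rewrite e yA in xA.
Qed.

Lemma gring_proj_gset_mul (F : fieldType) (gT : finGroupType) (G : {group gT})
    (A B : {set gT}) (x : gT) : A \subset G -> B \subset G -> x \in G ->
  gring_proj x (gset_mx F G A *m gset_mx F G B)%R =
  #|[set p : gT * gT | [&& p.1 \in A, p.2 \in B & (p.1 * p.2)%g == x]]|%:R%R.
Proof.
move=> /subsetP AG /subsetP BG Gx; rewrite /gset_mx mulmx_suml linear_sum /=.
rewrite -sum1_card natr_sum.
rewrite (eq_bigl (fun p : gT * gT => (p.1 \in A) && ((p.2 \in B) && ((p.1 * p.2)%g == x)))); last first.
  by move=> p; rewrite inE.
rewrite -(pair_big_dep (fun y => y \in A) (fun y z => (z \in B) && ((y * z)%g == x)) (fun _ _ => 1%R)).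
apply: eq_bigr => y yA; rewrite mulmx_sumr linear_sum /= big_mkcondr.
apply: eq_bigr => z zB; have [Gy Gz] := (AG _ yA, BG _ zB).
rewrite -repr_mxM // gring_projE ?groupM // eq_sym.
by case: eqP.
Qed.
Lemma Hset_sub n l d : Hset n l d \subset hyperoct n.
Proof. by apply/subsetP => w; rewrite inE => /andP[]. Qed.

Local Open Scope ring_scope.

Section Coefficients.
Import classical_sets cardinality fsbigop.

(** The classes are nonempty and pairwise disjoint, so sending [K] to its class is injective into
    the finite type of subsets of ['S_(n.*2)]. Finiteness lets the sum of [structure_coefs] be
    treated as an ordinary one. *)
Lemma finite_proper_pairs n :
  finite_set [set K : pairpart | proper_pair K /\ (wt K <= n)%N]%classic.
Proof.
pose f (K : pairpart) := Hset n (up1 n K) K.2.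
set S := (X in finite_set X).
have injf : {in S &, injective f}.
  move=> K K'; rewrite !in_setE => -[pK Kn] [pK' K'n] e.
  have [Z [z [_ _ /(_ n Kn)[h [injh zK]]]]] := exists_lift_Hset pK.
  by apply: (Hset_inj pK pK' Kn K'n zK); rewrite -[Hset _ _ _]e.
rewrite -(eq_finite_set (inj_card_eq injf)).
exact: finite_finset.
Qed.

(** The coefficients of [w] on both sides are compared: on the right, only the class of [K] contains
    [w]. *)
Lemma structure_coef_card (F : fieldType) c (hc : structure_coefs (F := F) c)
    (L M K : pairpart) n (w : 'S_(n.*2)) :
  proper_pair L -> proper_pair M -> proper_pair K ->
  (wt L <= n)%N -> (wt M <= n)%N -> (wt K <= n)%N ->
  w \in Hset n (up1 n K) K.2 ->
  c L M K n = #|[set p : 'S_(n.*2) * 'S_(n.*2) |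
    [&& p.1 \in Hset n (up1 n L) L.2, p.2 \in Hset n (up1 n M) M.2
      & (p.1 * p.2)%g == w]]|%:R.
Proof.
move=> pL pM pK Ln Mn Kn wK.
have hw : w \in hyperoct n by exact: (fintype.subsetP (Hset_sub _ _ _)) wK.
have := congr1 (gring_proj w) (hc L M n pL pM Ln Mn).
rewrite gring_proj_gset_mul ?Hset_sub // fsbig_finite; last exact: finite_proper_pairs.
rewrite linear_sum (bigD1_seq K) ?fset_uniq //=; last first.
  by rewrite in_fset_set ?in_setE //; exact: finite_proper_pairs.
rewrite big1_seq ?addr0 => [|K' /andP[K'K]]; last first.
  rewrite in_fset_set ?in_setE => [[pK' K'n]|]; last exact: finite_proper_pairs.
  rewrite linearZ /= gring_proj_gset ?Hset_sub //.
  case: (boolP (w \in _)) => [wK'|_]; last by rewrite scaler0.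
  by rewrite (Hset_inj pK' pK K'n Kn wK' wK) eqxx in K'K.
rewrite linearZ /= gring_proj_gset ?Hset_sub // wK.
(* Coefficients come as 1 by 1 matrices; the cardinal is written as a scalar matrix so that the
   single entries can be compared. *)
rewrite -[_%:R as X in X = _](rmorph_nat (@scalar_mx F 1)).
move=> /matrixP/(_ 0 0); rewrite !mxE eqxx !mulr1n mulr1.
by move=> <-.
Qed.

End Coefficients.

(** * The basis of shifted falling factorials *)

Section FallingFactorials.
Variables (F : numFieldType) (s : nat).

Lemma horner_ffact_poly k n : (s <= n)%N ->
  (ffact_poly F s k).[n%:R] = ((n - s) ^_ k)%:R.
Proof.
move=> sn; elim: k => [|k IH]; first by rewrite /ffact_poly big_ord0 hornerC.
rewrite /ffact_poly big_ord_recr /= hornerM -/(ffact_poly F s k) IH ffactnSr natrM.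
(* When [n - s < k], the natural subtraction truncates, but the product of the earlier factors is
   already 0. *)
rewrite hornerXsubC; case: (leqP k (n - s)) => [kn|kn].
  have skn : (s + k <= n)%N by rewrite -leq_subRL.
  by rewrite -subnDA natrB.
by rewrite ffact_small // !mul0r.
Qed.

Lemma size_ffact_poly k : size (ffact_poly F s k) = k.+1.
Proof. by rewrite size_prod_XsubC /index_enum -enumT size_enum_ord. Qed.

(** [nonneg_ffact_coefs] sums exactly up to the size, while [N] is only a bound. The basis has one
    polynomial in each degree, so the last nonzero coefficient fixes the size and the terms beyond
    it vanish. *)
Lemma ffact_poly_comb (b : nat -> F) N (p := \sum_(k < N) b k *: ffact_poly F s k) :
  (forall k, 0 <= b k) -> nonneg_ffact_coefs s p /\ (size p <= N)%N.
Proof.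
move=> b0; suff [pE pN] : p = \sum_(k < size p) b k *: ffact_poly F s k /\ (size p <= N)%N.
  by split=> //; exists b.
rewrite {}/p; elim: N => [|N [IHp IHs]].
  by rewrite big_ord0 size_poly0 big_ord0.
rewrite big_ord_recr /=; have [->|bN] := eqVneq (b N) 0.
  by rewrite scale0r addr0; split=> //; exact: leqW.
set q := \sum_(k < N) _ in IHs *.
have -> : size (q + b N *: ffact_poly F s N) = N.+1.
  by rewrite addrC size_polyDl size_scale // size_ffact_poly.
by rewrite big_ord_recr.
Qed.

End FallingFactorials.

(** * The polynomial and its degree *)

Theorem corollary6p8 (R : realType)
    (c : pairpart -> pairpart -> pairpart -> nat -> R[i])
    (hc : structure_coefs c)
    (L M K : pairpart) (hL : proper_pair L) (hM : proper_pair M) (hK : proper_pair K) :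
  exists p : {poly R[i]},
    [/\ forall n : nat, (wt L <= n)%N -> (wt M <= n)%N -> (wt K <= n)%N ->
          c L M K n = p.[n%:R],
        nonneg_ffact_coefs (wt K) p
      & p != 0 -> ((size p).-1 + wt K <= wt L + wt M)%N].
Proof.
have [Z [z [full_z cZ hz]]] := exists_lift_Hset hK.
pose a k := full_count L M z k.
(* From index [N] on, [full_count_eq0] makes [a] vanish. If [wt K] exceeds [wt L + wt M], the
   subtraction truncates to 0 and the polynomial is 0. *)
pose N := ((wt L + wt M).+1 - wt K)%N.
(* Division by the factorial turns binomials into falling factorials, as in [bin_ffact]. *)
pose b k : R[i] := (a k)%:R / (k`!)%:R.
have aN k : (N <= k)%N -> a k = 0%N.
  rewrite leq_subLR -cZ; exact: full_count_eq0.
have [b0 sN] := @ffact_poly_comb R[i] (wt K) b N (fun k => divr_ge0 (ler0n _ _) (ler0n _ _)).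
exists (\sum_(k < N) b k *: ffact_poly R[i] (wt K) k); split=> //.
  move=> n Ln Mn Kn; have [h [injh zK]] := hz n Kn.
  rewrite (structure_coef_card hc hL hM hK Ln Mn Kn zK) card_pairs_Hset //.
  rewrite card_factorizations // card_ord cZ horner_sum.
  pose f k := ('C(n - wt K, k) * a k)%N.
  have widen A B : (A <= B)%N -> (forall k, (A <= k)%N -> f k = 0%N) ->
      (\sum_(k < B) f k = \sum_(k < A) f k)%N.
    move=> AB f0; rewrite -!(big_mkord predT) (big_cat_nat (n := A)) //=.
    rewrite [X in (_ + X)%N]big_nat_cond [X in (_ + X)%N]big1 ?addn0 // => k.
    by case/andP=> /andP[/f0].
  (* Both ranges are compared with their sum: beyond [n - wt K] the binomials vanish, and from [N]
     on the numbers [a k] do. *)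
  have -> : (\sum_(k < (n - wt K).+1) f k = \sum_(k < N) f k)%N.
    rewrite -(widen _ (N + (n - wt K).+1)%N) ?leq_addl => [||k nk].
    - by apply: widen => [|k Nk]; rewrite ?leq_addr // /f aN ?muln0.
    - by [].
    - by rewrite /f bin_small.
  rewrite natr_sum; apply: eq_bigr => k _.
  rewrite hornerZ horner_ffact_poly // -bin_ffact /b !natrM.
  have k0 : (k`!)%:R != 0 :> R[i] by rewrite pnatr_eq0 -lt0n fact_gt0.
  by rewrite [RHS]mulrC -mulrA [X in _ = _ * X]mulrC divfK.
(* A nonzero polynomial forces [N] to be positive, so the subtraction in [N] is not truncated and
   the size bound gives the degree bound. *)
rewrite -size_poly_gt0 => p0; have := leq_trans p0 sN.
rewrite subn_gt0 => KLM; rewrite -ltnS -addSn prednK // addnC.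
by rewrite -leq_subRL // ltnW.
Qed.
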